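(* Let $G$ be a simple graph with $n\ge 2$ vertices and $m$ edges, and let $\vec r=(2,1,\dots,1)\in\mathbb{Z}^n$. Then the number of $i$-cells of $S_{\vec r}(G)$ is $$\#(i\text{-cells})=\begin{cases}\dfrac{n!\,(n^2+n-2)}{4}&\text{if } i=0,\\[2mm] \dfrac{m\,(n-1)!\,(n^2+n-4)}{2}&\text{if } i=1,\\[2mm] 0&\text{if } i\ge 2.\end{cases}$$
   Context: A simple graph has no loops or multiple edges. $V(G)$ is the set of vertices and $E(G)$ the set of closed edges (edges viewed as sets of points including their endpoints) of $G$. A color vector is a vector $\vec r=(\ell_1,\dots,\ell_r)$ of positive integers; $1,\dots,r$ are called colors. A cell of the grouped Stirling complex $S_{\vec r}(G)$ is an $r$-tuple $c=(c_1,\dots,c_r)$ such that: (a) $c_i\subset V(G)\cup E(G)$ and $|c_i|=\ell_i$ for $i=1,\dots,r$; (b) for each $v\in V(G)$ there is some $i$ with $v\in c_i$; (c) for each $i$, $\sigma\cap\sigma'=\emptyset$ for all distinct vertices and/or closed edges $\sigma,\sigma'\in c_i$. The dimension of $c$ is the number of (not necessarily distinct) edges appearing in $c$, i.e. $\sum_{i=1}^r|c_i\cap E(G)|$; a cell of dimension $k$ is called a $k$-cell. *)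

(* Defs.v *)
From HB Require Import structures.
From mathcomp Require Import all_boot all_order all_algebra.

Set Implicit Arguments.
Unset Strict Implicit.
Unset Printing Implicit Defensive.

Record simple_graph := SimpleGraph {
  vertex : finType;
  adj : rel vertex;
  adj_sym : symmetric adj;
  adj_irr : irreflexive adj
}.

(* A vertex or closed edge of G is encoded by the set of vertices lying on it:
   the vertex v by [set v], the edge joining x and y by [set x; y].  As two
   closed edges of a simple graph can meet only in a common endpoint, two such
   objects are disjoint as sets of points iff their encodings are disjoint. *)
Definition vertex_set (G : simple_graph) : {set {set vertex G}} :=
  [set [set v] | v : vertex G].

Definition edge_set (G : simple_graph) : {set {set vertex G}} :=
  [set [set p.1; p.2] | p : vertex G * vertex G & adj p.1 p.2].

Record color_vector (r : nat) := ColorVector {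
  color_size :> 'I_r -> nat;
  color_size_gt0 : forall i, 0 < color_size i
}.

Section GroupedStirlingComplex.

Variables (G : simple_graph) (r : nat) (l : color_vector r).

Implicit Type c : {ffun 'I_r -> {set {set vertex G}}}.

Definition is_cell c : bool :=
  [&& [forall i, (c i \subset vertex_set G :|: edge_set G)
                 && (#|c i| == l i)],
      [forall v : vertex G, exists i, [set v] \in c i] &
      [forall i, forall s in c i, forall t in c i,
        (s != t) ==> [disjoint s & t]]].

Definition cell_dim c : nat := \sum_(i < r) #|c i :&: edge_set G|.

Definition k_cells (k : nat) : {set {ffun 'I_r -> {set {set vertex G}}}} :=
  [set c | is_cell c & cell_dim c == k].

End GroupedStirlingComplex.

Definition two_ones_size (r : nat) (i : 'I_r) : nat :=
  if i == 0 :> nat then 2 else 1.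

Lemma two_ones_size_gt0 (r : nat) (i : 'I_r) : 0 < two_ones_size i.
Proof. by rewrite /two_ones_size; case: ifP. Qed.

Definition two_ones (r : nat) : color_vector r :=
  ColorVector (@two_ones_size_gt0 r).

(* Main.v *)
Require Import Defs.
From HB Require Import structures.
From mathcomp Require Import all_boot all_order all_algebra ring lra zify.

(* A cell for (2,1,...,1) is an (n+1)-tuple (t0, t1, ..., tn) of vertices and
   edges, t0 and t1 being disjoint, up to exchanging t0 and t1.  As the n
   vertices all occur, at most one entry is an edge, so the set of entries is V
   in dimension 0 and V together with an edge e in dimension 1.  The
   (n+1)-tuples with set of entries V number C(n+1, 2) n!, of which n! have
   t0 = t1; those with set of entries V + e number (n+1)!, and in 4 (n-1)! of
   them t0 and t1 are e and one of its ends. *)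

Set Implicit Arguments.
Unset Strict Implicit.
Unset Printing Implicit Defensive.

Import GRing.Theory.

(** * Counting tuples with a prescribed set of entries *)

Lemma card_tuple_cons (T : finType) n (P : pred (n.+1.-tuple T)) :
  #|[set t | P t]| = \sum_x #|[set t : n.-tuple T | P [tuple of x :: t]]|.
Proof.
under eq_bigr => x _ do rewrite -sum1dep_card.
rewrite pair_big_dep /= -sum1dep_card.
rewrite (reindex (fun p : T * n.-tuple T => [tuple of p.1 :: p.2])) //=.
exists (fun t : n.+1.-tuple T => (thead t, [tuple of behead t])).
  by move=> [x t] _ /=; congr pair; apply: val_inj.
by move=> t _; case/tupleP: t => x t; apply: val_inj.
Qed.

(** These are the surjections from n indices onto [B]; for |B| = k their number is k! S(n, k), with
    S the Stirling number of the second kind. *)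
Definition spanning_tuples (T : finType) n (B : {set T}) :=
  [set t : n.-tuple T | [set x in t] == B].

Section SpanningTuples.

Variable T : finType.
Implicit Types B : {set T}.

Lemma set_mem_cons (x : T) (s : seq T) :
  [set y in x :: s] = x |: [set y in s].
Proof. by apply/setP=> y; rewrite !inE. Qed.

(** When [x] lies in [B], the tail either contains [x] and spans [B], or omits [x] and spans
    [B :\ x]; the two cases exclude each other. *)
Lemma card_setU1_spanning n B x :
  #|[set t : n.-tuple T | x |: [set y in t] == B]| =
  if x \in B then #|spanning_tuples n B| + #|spanning_tuples n (B :\ x)| else 0.
Proof.
case: ifPn => xB; last first.
  apply/eqP; rewrite cards_eq0 -subset0; apply/subsetP=> t; rewrite !inE.
  by move/eqP=> tB; rewrite -tB setU11 in xB.
rewrite -cardsUI.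
have -> : spanning_tuples n B :&: spanning_tuples n (B :\ x) = set0.
  apply/setP=> t; rewrite !inE; apply/negP=> /andP[/eqP-> /eqP eB].
  by have := setD11 x B; rewrite -eB xB.
rewrite cards0 addn0; apply: eq_card => t; rewrite !inE.
apply/eqP/orP => [<- | [/eqP-> | /eqP->]].
- case: (boolP (x \in [set y in t])) => xt.
    by left; rewrite (setUidPr _) // sub1set.
  by right; rewrite setU1K.
- by rewrite (setUidPr _) // sub1set.
- by rewrite setD1K.
Qed.

Lemma card_spanningS n B :
  #|spanning_tuples n.+1 B| =
  \sum_(x in B) (#|spanning_tuples n B| + #|spanning_tuples n (B :\ x)|).
Proof.
rewrite card_tuple_cons [RHS]big_mkcond; apply: eq_bigr => x _ /=.
by rewrite -card_setU1_spanning; apply: eq_card => t; rewrite !inE set_mem_cons.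
Qed.

Lemma card_spanning_gt n B : n < #|B| -> #|spanning_tuples n B| = 0.
Proof.
move=> ltnB; apply/eqP; rewrite cards_eq0 -subset0; apply/subsetP=> t.
rewrite !inE => /eqP tB; have := card_size t.
by rewrite size_tuple leqNgt -cardsE tB ltnB.
Qed.

Lemma card_spanning_eq n B : #|B| = n -> #|spanning_tuples n B| = n`!.
Proof.
elim: n B => [|n IHn] B cardB.
  rewrite (_ : spanning_tuples 0 B = setT) ?cardsT ?card_tuple //.
  apply/setP=> t; rewrite tuple0 !inE (cards0_eq cardB).
  by apply/eqP/setP=> x; rewrite !inE.
(* In the recurrence only the term of [B :\ x] survives, since n entries cannot span n+1
   elements. *)
rewrite card_spanningS (eq_bigr (fun=> n`!)) ?sum_nat_const ?cardB ?factS //.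
move=> x xB; rewrite card_spanning_gt ?cardB // IHn //.
by move: cardB; rewrite (cardsD1 x) xB => -[].
Qed.

(** In the recurrence the tail either orders all of [B] without repetition or again spans one
    element less than its length; Pascal's rule adds up the two contributions. *)
Lemma card_spanning_succ n B :
  #|B| = n -> #|spanning_tuples n.+1 B| = 'C(n.+1, 2) * n`!.
Proof.
elim: n B => [|n IHn] B cardB.
  by rewrite card_spanningS (cards0_eq cardB) big_set0.
rewrite card_spanningS (eq_bigr (fun=> n.+1`! + 'C(n.+1, 2) * n`!)).
  by rewrite sum_nat_const cardB (binS n.+1) bin1 factS; ring.
move=> x xB; rewrite card_spanning_eq // IHn //.
by move: cardB; rewrite (cardsD1 x) xB => -[].
Qed.

(** If [x] occurred in [s], then [s] alone would have to span [B], for which it is too short. *)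
Lemma setU1_set_mem B (s : seq T) x : size s < #|B| ->
  (x |: [set y in s] == B) = (x \in B) && ([set y in s] == B :\ x).
Proof.
move=> ltsB; apply/eqP/andP => [sB | [xB /eqP->]]; last exact: setD1K.
split; first by rewrite -sB setU11.
rewrite -sB setU1K //; apply: contraTN ltsB => xs.
rewrite -sB (setUidPr _) ?sub1set // -leqNgt cardsE.
exact: card_size.
Qed.

End SpanningTuples.

(** * Vertices and edges as sets of vertices *)

Section Objects.

Variable G : simple_graph.
Notation T := {set vertex G}.
Notation V := (vertex_set G).
Notation E := (edge_set G).

Lemma vertexP (s : T) : reflect (exists v, s = [set v]) (s \in V).
Proof.
apply: (iffP imsetP) => [[v _ ->]|[v ->]]; first by exists v.
by exists v.
Qed.

Lemma set1_vertex (v : vertex G) : [set v] \in V.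
Proof. exact: imset_f. Qed.

Lemma card_vertex_set : #|V| = #|vertex G|.
Proof. by rewrite card_imset //; apply: set1_inj. Qed.

Lemma card_edge (e : T) : e \in E -> #|e| = 2.
Proof.
case/imsetP=> -[x y] /=; rewrite inE /= => xy ->; rewrite cards2.
by case: eqP xy => // ->; rewrite adj_irr.
Qed.

Lemma edge_notin_vertex_set (e : T) : e \in E -> e \notin V.
Proof.
by move/card_edge=> e2; apply/vertexP=> -[v ev]; rewrite ev cards1 in e2.
Qed.

Lemma object_neq0 (s : T) : s \in V :|: E -> s != set0.
Proof.
rewrite inE -card_gt0 => /orP[/vertexP[v ->]|/card_edge->] //.
by rewrite cards1.
Qed.

(** An object is nonempty, hence not disjoint from itself. *)
Lemma disjoint_object_neq (s t : T) :
  s \in V :|: E -> [disjoint s & t] -> s != t.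
Proof.
move=> /object_neq0 s0 dst; apply: contra_neq s0 => st.
by move: dst; rewrite -st -setI_eq0 setIid => /eqP.
Qed.

Lemma sum_setU1_vertex_set (e : T) (F : T -> nat) : e \in E ->
  \sum_(s in e |: V) F s = F e + \sum_v F [set v].
Proof.
move=> eE; rewrite big_setU1 ?edge_notin_vertex_set //=; congr addn.
by rewrite big_imset //= => v w _ _; apply: set1_inj.
Qed.

Lemma sum_mem_edge (e : T) : e \in E -> \sum_v (v \in e : nat) = 2.
Proof. by move=> eE; rewrite -(card_edge eE) -sum1_card [RHS]big_mkcond. Qed.

(** The edge meets itself and, in both orders, each of its two ends: 1 + 4 pairs. Among vertices,
    each meets only itself. *)
Lemma sum_meeting_pairs (e : T) : e \in E ->
  \sum_(s in e |: V) \sum_(t in e |: V) ~~ [disjoint s & t] = #|vertex G| + 5.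
Proof.
move=> eE; rewrite sum_setU1_vertex_set // sum_setU1_vertex_set //.
(* The row of [v] contributes 1 for [v] itself, and 1 more if [v] is an end of [e]. *)
under [X in _ + X]eq_bigr => v _.
  rewrite sum_setU1_vertex_set // disjoints1 negbK.
  under eq_bigr => w _ do rewrite disjoints1 negbK in_set1.
  rewrite (bigD1 v) //= eqxx big1 ?addn0; last first.
    by move=> w /negPf; rewrite eq_sym => ->.
over.
under eq_bigr => w _ do rewrite disjoint_sym disjoints1 negbK.
rewrite big_split /= sum1_card !sum_mem_edge //.
rewrite -setI_eq0 setIid -card_gt0 card_edge //=.
by rewrite addnA addnC.
Qed.

End Objects.

(** * Cells as tuples up to exchanging the first two entries *)

Section OrderedCells.

Variables (G : simple_graph) (n : nat).
Notation T := {set vertex G}.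
Notation V := (vertex_set G).
Notation E := (edge_set G).
Implicit Types t : n.+2.-tuple T.

(** The color [ord0] of size 2 receives the entries t0 and t1; every other color i receives the
    single entry of index i+1. *)
Definition cell_of t : {ffun 'I_n.+1 -> {set T}} :=
  [ffun i =>
    tnth t (lift ord0 i) |: (if i == ord0 then [set thead t] else set0)].

(** Only the color [ord0] has two elements, so condition (c) becomes disjointness of t0 and t1; this
    also makes them distinct, as the size 2 demands. *)
Definition ordered_cell t : bool :=
  [&& all [in V :|: E] t, V \subset [set s in t] &
      [disjoint thead t & tnth t (lift ord0 ord0)]].

Lemma cell_of_ord0 x y (s : n.-tuple T) :
  cell_of [tuple of x :: y :: s] ord0 = [set x; y].
Proof. by rewrite ffunE eqxx tnthS theadE tnth0 setUC. Qed.

Lemma cell_of_lift x y (s : n.-tuple T) j :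
  cell_of [tuple of x :: y :: s] (lift ord0 j) = [set tnth s j].
Proof. by rewrite ffunE (eq_sym _ ord0) (negPf (neq_lift _ _)) !tnthS setU0. Qed.

Lemma mem_cell_of t z : reflect (exists i, z \in cell_of t i) (z \in t).
Proof.
case/tupleP: t => x t; case/tupleP: t => y s.
rewrite !inE; apply: (iffP idP) => [|[i]].
- case/or3P=> [zx|zy|/tnthP[j ->]].
  + by exists ord0; rewrite cell_of_ord0 !inE zx.
  + by exists ord0; rewrite cell_of_ord0 !inE zy orbT.
  + by exists (lift ord0 j); rewrite cell_of_lift inE.
- case: (unliftP ord0 i) => [j|] ->.
    by rewrite cell_of_lift inE => /eqP->; rewrite mem_tnth !orbT.
  by rewrite cell_of_ord0 !inE => /orP[]->; rewrite ?orbT.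
Qed.

Lemma is_cell_cell_of t : is_cell (two_ones n.+1) (cell_of t) = ordered_cell t.
Proof.
have memP := mem_cell_of t.
have covE :
  [forall v, exists i, [set v] \in cell_of t i] = (V \subset [set s in t]).
  apply/forallP/subsetP => [cov s /vertexP[v ->] | cov v].
    by rewrite inE; apply/memP; apply/existsP.
  by apply/existsP/memP; have := cov _ (set1_vertex v); rewrite inE.
rewrite /is_cell /ordered_cell covE andbCA [RHS]andbCA; congr andb.
case/tupleP: t memP {covE} => x t; case/tupleP: t => y s memP.
rewrite tnthS tnth0 theadE.
apply/andP/andP => [[/forallP cX /forallP cD] | [/allP tX dxy]].
  have tX z : z \in [tuple of x :: y :: s] -> z \in V :|: E.
    by case/memP=> i; have /andP[/subsetP sX _] := cX i; apply: sX.
  split; first exact/allP.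
  (* The size 2 of the first color forces [x != y], so that (c) applies to this pair. *)
  have /andP[_] := cX ord0; rewrite cell_of_ord0 cards2 /= => xy.
  have := cD ord0; rewrite cell_of_ord0 => /forallP/(_ x).
  rewrite !inE eqxx /= => /forallP/(_ y); rewrite !inE eqxx orbT /=.
  by case: (x != y) xy.
have xy : x != y by apply: disjoint_object_neq dxy; rewrite tX ?inE ?eqxx.
split; apply/forallP=> i.
  apply/andP; split; first by apply/subsetP=> z zi; apply/tX/memP; exists i.
  case: (unliftP ord0 i) => [j|] ->; first by rewrite cell_of_lift cards1.
  by rewrite cell_of_ord0 cards2 xy.
apply/forall_inP=> u ui; apply/forall_inP=> w wi; apply/implyP.
case: (unliftP ord0 i) ui wi => [j|] ->.
  by rewrite cell_of_lift !inE => /eqP-> /eqP->; rewrite eqxx.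
rewrite cell_of_ord0 !inE => /orP[]/eqP-> /orP[]/eqP->; rewrite ?eqxx //.
by rewrite disjoint_sym.
Qed.

(** Both sides count an edge as often as it is used: different colors are counted separately, and
    within [ord0] the entries t0 and t1 differ. *)
Lemma cell_dim_cell_of t :
  ordered_cell t -> cell_dim (cell_of t) = count [in E] t.
Proof.
case/tupleP: t => x t; case/tupleP: t => y s.
rewrite /ordered_cell theadE tnthS tnth0 => /and3P[/allP tX _ dxy].
have xy : x != y by apply: disjoint_object_neq dxy; rewrite tX ?inE ?eqxx.
have card1E z : #|[set z] :&: E| = (z \in E).
  case: (boolP (z \in E)) => zE; first by rewrite (setIidPl _) ?cards1 ?sub1set.
  by apply/eqP; rewrite cards_eq0 setI_eq0 disjoints1.
rewrite /cell_dim big_ord_recl cell_of_ord0 /= addnA; congr addn.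
  rewrite setIUl cardsU !card1E setIACA (_ : _ :&: [set y] = set0).
    by rewrite set0I cards0 subn0.
  by apply/eqP; rewrite setI_eq0 disjoints1 inE.
rewrite -sum1_count big_tuple [RHS]big_mkcond; apply: eq_bigr => j _.
by rewrite cell_of_lift card1E; case: (_ \in _).
Qed.

(* Recording which of [t0], [t1] comes first restores the order lost in the
   unordered pair [{t0, t1}], so each cell has exactly two orderings. *)
Lemma card_ordered_cells (P : pred {ffun 'I_n.+1 -> {set T}}) :
  #|[set t | ordered_cell t & P (cell_of t)]| =
  2 * #|[set c | is_cell (two_ones n.+1) c & P c]|.
Proof.
(* [enum_rank] supplies an arbitrary total order on the objects. *)
pose lt (x y : T) := enum_rank x < enum_rank y.
pose first t := lt (thead t) (tnth t (lift ord0 ord0)).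
have lt_neg x y : x != y -> lt x y = ~~ lt y x.
  move=> xy; rewrite /lt -leqNgt [RHS]leq_eqVlt.
  by rewrite (inj_eq (@ord_inj _)) (inj_eq enum_rank_inj) (negPf xy).
have ltE x y (s : n.-tuple T) : first [tuple of x :: y :: s] = lt x y.
  by rewrite /first theadE tnthS tnth0.
rewrite mulnC -card_bool -cardsT -cardsX.
(* The map from ordered cells to pairs of a cell and a boolean is injective; its image is computed
   afterwards. *)
rewrite -(card_in_imset (f := fun t => (cell_of t, first t))); last first.
  move=> t t'; case/tupleP: t => x t; case/tupleP: t => y s.
  case/tupleP: t' => x' t'; case/tupleP: t' => y' s'.
  rewrite !inE => /andP[ot _] /andP[ot' _] [ec]; rewrite !ltE.
  move: ot; rewrite /ordered_cell theadE tnthS tnth0 => /and3P[/allP tX _ dxy].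
  have xy : x != y by apply: disjoint_object_neq dxy; rewrite tX ?inE ?eqxx.
  have es : s = s'.
    apply: eq_from_tnth => j; move/ffunP/(_ (lift ord0 j)): ec.
    by rewrite !cell_of_lift => /set1_inj.
  move/ffunP/(_ ord0): ec; rewrite !cell_of_ord0 => e01.
  have: (x' \in [set x; y]) && (y' \in [set x; y]) by rewrite e01 !inE !eqxx orbT.
  have xin : x \in [set x'; y'] by rewrite -e01 !inE eqxx.
  have yin : y \in [set x'; y'] by rewrite -e01 !inE eqxx orbT.
  (* Equal first two entries contradict [x != y], and an exchange would flip the value of
     [first]. *)
  rewrite !inE => /andP[/orP[]/eqP ex' /orP[]/eqP ey']; subst.
  - by move: yin; rewrite !inE orbb eq_sym (negPf xy).
  - by [].
  - by rewrite lt_neg //; case: (lt y x).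
  - by move: xin; rewrite !inE orbb (negPf xy).
apply: eq_card => -[c b]; rewrite !inE andbT /=; apply/imsetP/andP => [[t]|[cc Pc]].
  by rewrite inE => /andP[ot Pt] [-> _]; rewrite is_cell_cell_of.
have [/forallP cX _ _] := and3P cc.
have [x [y [xy c0 xyb]]] :
    exists x, exists y, [/\ x != y, c ord0 = [set x; y] & lt x y = b].
  have /andP[_] := cX ord0; rewrite /= => /cards2P[x [y [xy c0]]].
  have [<-|xyb] := eqVneq (lt x y) b; first by exists x, y.
  exists y, x; split; [by rewrite eq_sym | by rewrite c0 setUC |].
  by rewrite lt_neg 1?eq_sym //; case: (lt x y) b xyb => -[].
(* [sigW] makes the element of each singleton color available as data, from which the tuple is
   built. *)
have cs j : {s | c (lift ord0 j) == [set s]}.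
  by apply: sigW; have /andP[_ /cards1P[s ->]] := cX (lift ord0 j); exists s.
have ec : cell_of [tuple of x :: y :: [tuple sval (cs j) | j < n]] = c.
  apply/ffunP=> i; case: (unliftP ord0 i) => [j|] ->.
    by rewrite cell_of_lift tnth_mktuple; case: (cs j) => s /= /eqP.
  by rewrite cell_of_ord0.
exists [tuple of x :: y :: [tuple sval (cs j) | j < n]]; last by rewrite ec ltE xyb.
by rewrite inE -is_cell_cell_of ec cc.
Qed.

End OrderedCells.

(** * Counting ordered cells by dimension, for n+1 vertices and n+2 entries *)

Section CountOrderedCells.

Variables (G : simple_graph) (n : nat).
Hypothesis cardG : #|vertex G| = n.+1.
Notation T := {set vertex G}.
Notation V := (vertex_set G).
Notation E := (edge_set G).
Implicit Types t : n.+2.-tuple T.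

Lemma count_vertex_ge t : V \subset [set s in t] -> n.+1 <= count [in V] t.
Proof.
move=> /subsetP Vt; rewrite -size_filter.
suff: #|V| <= size [seq s <- t | s \in V] by rewrite card_vertex_set cardG.
rewrite cardE; apply: uniq_leq_size (enum_uniq _) _ => s; rewrite mem_enum => sV.
by rewrite mem_filter sV; have := Vt s sV; rewrite inE.
Qed.

Lemma count_vertex_edge t :
  all [in V :|: E] t -> count [in V] t + count [in E] t = n.+2.
Proof.
move=> /allP tX; rewrite -[RHS](size_tuple t) -(count_predC [in E]) addnC.
congr addn; apply: eq_in_count => s /tX; rewrite !inE /=.
by case: (boolP (s \in E)) => [/edge_notin_vertex_set/negPf-> //|_]; rewrite orbF.
Qed.

(** Of the n+2 entries, at least n+1 are vertices. *)
Lemma ordered_cell_dim_le1 t : ordered_cell t -> count [in E] t <= 1.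
Proof. by case/and3P=> /count_vertex_edge tX /count_vertex_ge; lia. Qed.

(** Without edges the entries are exactly the vertices, and two vertices are disjoint iff they
    differ. *)
Lemma ordered_cell_dim0 t :
  ordered_cell t && (count [in E] t == 0) =
  ([set s in t] == V) && (thead t != tnth t (lift ord0 ord0)).
Proof.
apply/andP/andP => [[/and3P[/allP tX Vt dt] /eqP c0] | [/eqP tV t01]].
  split; last by apply: disjoint_object_neq dt; apply/tX/mem_tnth.
  rewrite eqEsubset Vt andbT; apply/subsetP=> s; rewrite inE => st.
  have := tX s st; rewrite inE => /orP[//|sE].
  by move/eqP: c0; rewrite -leqn0 leqNgt -has_count; case/negP; apply/hasP; exists s.
have tX s : s \in t -> s \in V by rewrite -tV inE.
split; last first.
  rewrite -leqn0 leqNgt -has_count; apply/hasPn=> s /tX.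
  by apply: contraL => /edge_notin_vertex_set.
apply/and3P; split; [by apply/allP=> s /tX; rewrite inE => -> | by rewrite tV |].
have /vertexP[u eu] := tX _ (mem_tnth ord0 t).
have /vertexP[w ew] := tX _ (mem_tnth (lift ord0 ord0) t).
by move: t01; rewrite /thead eu ew disjoints1 inE (inj_eq set1_inj).
Qed.

Lemma ordered_cell_dim1 t :
  ordered_cell t && (count [in E] t == 1) =
  [exists e in E, [set s in t] == e |: V] &&
  [disjoint thead t & tnth t (lift ord0 ord0)].
Proof.
apply/andP/andP => [[/and3P[tX Vt dt] /eqP c1] | [/exists_inP[e eE /eqP tV] dt]].
  split=> //; have /hasP[e et eE] : has [in E] t by rewrite has_count c1.
  apply/exists_inP; exists e => //.
  rewrite eqEsubset subUset sub1set inE et Vt !andbT; apply/subsetP=> s.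
  rewrite !inE => st; have /orP[->|sE] : (s \in V) || (s \in E).
  - by have := allP tX s st; rewrite inE.
  - by rewrite orbT.
  (* The list of edge entries has length one, so the edge [s] must be [e]. *)
  have : size [seq s <- t | s \in E] = 1 by rewrite size_filter.
  case def_t: [seq s <- t | s \in E] => [|z []] // _.
  have : s \in [seq s <- t | s \in E] by rewrite mem_filter sE.
  have : e \in [seq s <- t | s \in E] by rewrite mem_filter [_ \in E]eE.
  by rewrite def_t !inE => /eqP-> ->.
have tX s : s \in t -> (s == e) || (s \in V).
  move=> st; have: s \in [set s in t] by rewrite inE.
  by rewrite tV !inE.
have ot : ordered_cell t.
  apply/and3P; split; rewrite ?dt ?tV ?subsetUr //.
  by apply/allP=> s /tX /orP[/eqP->|sV]; rewrite inE ?eE ?sV ?orbT.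
split=> //; rewrite eqn_leq ordered_cell_dim_le1 //= -has_count.
apply/hasP; exists e => //.
by have: e \in [set s in t]; [rewrite tV setU11 | rewrite inE].
Qed.

(** Among the tuples spanning [V], those with t0 = t1 become, on dropping t0, the orderings of [V].
    The additive form avoids truncated subtraction. *)
Lemma card_dim0 :
  #|[set t : n.+2.-tuple T | ordered_cell t & count [in E] t == 0]| + n.+1`! =
  'C(n.+2, 2) * n.+1`!.
Proof.
have cardV : #|V| = n.+1 by rewrite card_vertex_set.
rewrite -(card_spanning_succ cardV) -(card_spanning_eq cardV).
rewrite -(cardsID [set t : n.+2.-tuple T | thead t == tnth t (lift ord0 ord0)]
                  (spanning_tuples n.+2 V)) addnC; congr addn; last first.
  by apply: eq_card => t; rewrite !inE ordered_cell_dim0 andbC.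
rewrite (_ : _ :&: _ = [set t : n.+2.-tuple T |
  ([set s in t] == V) && (thead t == tnth t (lift ord0 ord0))]); last first.
  by apply/setP=> t; rewrite !inE.
rewrite !card_tuple_cons; apply: eq_bigr => x _.
rewrite card_tuple_cons (bigD1 x) //= big1 ?addn0 => [|y yx].
  apply: eq_card => s; rewrite !inE theadE tnthS tnth0 eqxx andbT.
  by rewrite !set_mem_cons setUA setUid.
apply/eqP; rewrite cards_eq0; apply/eqP/setP=> s.
by rewrite !inE theadE tnthS tnth0 (eq_sym x) (negPf yx) andbF.
Qed.

(** Each ordered pair of disjoint elements of [e |: V] begins n! orderings of that set. Of its
    (n+2)^2 ordered pairs, the n+6 meeting ones, diagonal included, are excluded. *)
Lemma card_disjoint_spanning (e : T) : e \in E ->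
  #|[set t : n.+2.-tuple T | ([set s in t] == e |: V) &&
             [disjoint thead t & tnth t (lift ord0 ord0)]]| + n`! * (n + 6) =
  n`! * n.+2 ^ 2.
Proof.
move=> eE; set B := e |: V.
have cardB : #|B| = n.+2.
  by rewrite cardsU1 edge_notin_vertex_set // card_vertex_set cardG.
have BX s : s \in B -> s \in V :|: E.
  by rewrite !inE => /orP[/eqP->|->]; rewrite ?eE ?orbT.
have -> : n.+2 ^ 2 = \sum_(s in B) \sum_(t in B)
    ([disjoint s & t] + ~~ [disjoint s & t]).
  rewrite (eq_bigr (fun=> n.+2)); first by rewrite sum_nat_const cardB.
  move=> s _; rewrite -cardB -sum1_card; apply: eq_bigr => t _.
  by case: [disjoint s & t].
under [in RHS]eq_bigr => s _ do rewrite big_split.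
rewrite big_split /= sum_meeting_pairs // cardG addSnnS [RHS]mulnDr; congr addn.
rewrite card_tuple_cons big_distrr [RHS]big_mkcond; apply: eq_bigr => x _ /=.
rewrite card_tuple_cons; case: (boolP (x \in B)) => xB; last first.
  apply: big1 => y _; apply/eqP; rewrite cards_eq0 -subset0.
  apply/subsetP=> s; rewrite !inE !set_mem_cons => /andP[/eqP sB].
  by rewrite -sB setU11 in xB.
rewrite big_distrr [RHS]big_mkcond; apply: eq_bigr => y _ /=.
have cardBx : #|B :\ x| = n.+1 by move: cardB; rewrite (cardsD1 x) xB => -[].
(* The n+2 entries span n+2 elements without repetition, so [x] and [y] can be removed from [B] in
   turn. *)
transitivity #|[set s : n.-tuple T | [&& y \in B :\ x,
    [set z in s] == B :\ x :\ y & [disjoint x & y]]]|.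
  apply: eq_card => s; rewrite !inE theadE tnthS tnth0 set_mem_cons.
  rewrite setU1_set_mem; last by rewrite cardB /= size_tuple.
  rewrite xB set_mem_cons.
  by rewrite setU1_set_mem ?size_tuple ?cardBx //= !inE -!andbA.
case: (boolP [disjoint x & y]) => dxy; last first.
  rewrite muln0 if_same; apply/eqP; rewrite cards_eq0; apply/eqP/setP=> s.
  by rewrite !inE !andbF.
have yx : y != x by rewrite eq_sym; apply: disjoint_object_neq dxy; apply: BX.
rewrite muln1 in_setD1 yx /=; case: (boolP (y \in B)) => yB; last first.
  by apply/eqP; rewrite cards_eq0; apply/eqP/setP=> s; rewrite !inE.
rewrite -(card_spanning_eq (B := B :\ x :\ y)).
  by apply: eq_card => s; rewrite !inE andbT.
by move: cardBx; rewrite (cardsD1 y) in_setD1 yx yB => -[].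
Qed.

(** The set [e |: V] determines [e], so summing over the edges counts each ordered cell of dimension
    1 once. *)
Lemma card_dim1 :
  #|[set t : n.+2.-tuple T | ordered_cell t & count [in E] t == 1]| +
    #|E| * (n`! * (n + 6)) =
  #|E| * (n`! * n.+2 ^ 2).
Proof.
rewrite -!sum_nat_const.
under [in RHS]eq_bigr => e eE do rewrite -(card_disjoint_spanning eE).
rewrite big_split /=; congr addn.
under eq_bigr => e _ do rewrite -sum1dep_card big_mkcond.
rewrite exchange_big /= -sum1dep_card big_mkcond; apply: eq_bigr => t _.
rewrite ordered_cell_dim1.
have [dt|_] := boolP [disjoint _ & _]; last first.
  by rewrite andbF big1 // => e _; rewrite andbF.
rewrite andbT; case: ifP => [/exists_inP[e eE /eqP tV]|tN].
  rewrite (bigD1 e) //= tV eqxx big1 // => e' /andP[e'E e'e].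
  rewrite andbT; case: eqP => // /setP/(_ e').
  by rewrite !inE eqxx (negPf e'e) (negPf (edge_notin_vertex_set e'E)).
rewrite big1 // => e eE; rewrite andbT; case: eqP => // tV.
by case/exists_inP: tN; exists e; rewrite ?tV.
Qed.

Lemma card_k_cells k :
  2 * #|k_cells G (two_ones n.+1) k| =
  #|[set t : n.+2.-tuple T | ordered_cell t & count [in E] t == k]|.
Proof.
rewrite -(card_ordered_cells (fun c => cell_dim c == k)).
apply: eq_card => t; rewrite !inE.
by case: (boolP (ordered_cell t)) => // /cell_dim_cell_of->.
Qed.

End CountOrderedCells.

(** * The closed formulas over the rationals *)

Local Open Scope ring_scope.

Theorem theorem4p1 (G : simple_graph) (n m : nat)
    (hn2 : (2 <= n)%N) (hn : #|vertex G| = n) (hm : #|edge_set G| = m)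
    (i : nat) :
  #|k_cells G (two_ones n) i|%:R =
    match i with
    | 0 => n`!%:R * (n%:R ^+ 2 + n%:R - 2) / 4
    | 1 => m%:R * (n.-1)`!%:R * (n%:R ^+ 2 + n%:R - 4) / 2
    | _ => 0
    end :> rat.
Proof.
case: n hn2 hn => // n _ hn.
have cells := card_k_cells G n i.
case: i cells => [|[|i]] cells.
(* [mul_bin_diag] gives (n+2)(n+1) = 2 C(n+2, 2), from which the binomial is solved for in the
   rationals. *)
- have := mul_bin_diag n.+2 1; have := card_dim0 hn; rewrite -cells bin1 -pred_Sn.
  move: #|k_cells _ _ _| (n.+1)`! 'C(_, _) => c f b.
  move=> /(congr1 (fun k => k%:R : rat)) dim0 /(congr1 (fun k => k%:R : rat)).
  move: dim0; rewrite natrD !natrM -(natr1 n.+1) -(natr1 n).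
  move: c%:R f%:R b%:R n%:R => {}c {}f {}b x dim0 bE.
  have {}bE : b = (x + 2) * (x + 1) / 2 by lra.
  rewrite bE in dim0; lra.
- have := card_dim1 hn; rewrite -cells hm -pred_Sn.
  move: #|k_cells _ _ _| n`! => c f /(congr1 (fun k => k%:R : rat)).
  rewrite !natrD !natrM natrD -(natr1 n.+1) -(natr1 n).
  move: c%:R f%:R m%:R n%:R => {}c {}f e x; lra.
- suff -> : #|k_cells G (two_ones n.+1) i.+2| = 0%N by [].
  (* Twice this number counts the ordered cells with i+2 edges, and there are none. *)
  apply/eqP; rewrite -(eqn_pmul2l (isT : 0 < 2)%N) cells muln0 cards_eq0.
  rewrite -subset0; apply/subsetP=> t; rewrite !inE => /andP[ot /eqP tE].
  by have := ordered_cell_dim_le1 hn ot; rewrite tE.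
Qed.
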